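(* The generalized hypergeometric function ${}_pF_q\left(\begin{smallmatrix} a_1,&a_2,&\ldots,&a_p\\ b_1,&b_2,&\ldots,&b_q\end{smallmatrix}\Big|\,x\right)$ satisfies the derivative rules $$\theta F_n(x)=n\,\bigl(F_{n+1}(x)-F_n(x)\bigr)$$ for any of its numerator parameters $n:=a_k$ $(k=1,\ldots,p)$, and $$\theta F_n(x)=(n-1)\,\bigl(F_{n-1}(x)-F_n(x)\bigr)$$ for any of its denominator parameters $n:=b_k$ $(k=1,\ldots,q)$, and recursive substitution of all occurrences of $\theta$ in the hypergeometric differential equation $$\theta(\theta+b_1-1)\cdots(\theta+b_q-1)F_n(x)=x(\theta+a_1)(\theta+a_2)\cdots(\theta+a_p)F_n(x)$$ (by the derivative rule for the chosen parameter) generates a recurrence equation of the type $\sum_{k=0}^{M} q_k(n,x)\,F_{n-k}(x)=0$ of order $M=\max\{p,q+1\}$ with respect to the parameter $n$ chosen. This recurrence equation has coefficients that are rational with respect to $x$ and $n$. In particular, ${}_pF_q$ forms an admissible family of order $\max\{p,q+1\}$ with respect to all of its parameters $a_k,b_k$.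
   Context: The generalized hypergeometric function is ${}_pF_q\left(\begin{smallmatrix} a_1,&\ldots,&a_p\\ b_1,&\ldots,&b_q\end{smallmatrix}\Big|\,x\right):=\sum_{k=0}^\infty \frac{(a_1)_k\cdots(a_p)_k}{(b_1)_k\cdots(b_q)_k\,k!}x^k$, with Pochhammer symbol $(a)_k=\prod_{j=1}^k(a+j-1)$. The operator $\theta$ is $\theta f(x)=x f'(x)$. If one of the parameters is chosen and called $n$, then $F_n(x)$ denotes ${}_pF_q$ as a function of that parameter, all other parameters being fixed; $F_{n\pm1}$ means that only this parameter is shifted by $\pm1$. An admissible family of special functions $(f_n)_{n\in D}$ ($D$ closed under $n\mapsto n+1$ or under $n\mapsto n-1$) is one that satisfies both a derivative rule, i.e. either $f_n'(x)=\sum_{k=0}^{M-1} r_k(n,x)f_{n-k}(x)$ or $f_n'(x)=\sum_{k=0}^{M-1} r_k(n,x)f_{n+k}(x)$ with $r_k$ rational functions in $x$, and a recurrence equation $\sum_{k=0}^m q_k(n,x)f_{n-k}(x)=0$ with $q_k$ polynomials in $x$ (after clearing denominators). The recurrence equation has order $m$ if $q_0(n,x)\not\equiv0$ and $q_m(n,x)\not\equiv 0$; the order of the admissible family is the order of the recurrence equation. *)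

(* Defs.v *)
From HB Require Import structures.
From mathcomp Require Import all_boot all_order all_algebra.
From mathcomp Require Import complex.
From mathcomp Require Import all_classical all_reals all_analysis.

Set Implicit Arguments.
Unset Strict Implicit.
Unset Printing Implicit Defensive.

Import Order.TTheory GRing.Theory Num.Theory numFieldNormedType.Exports.
Local Open Scope classical_set_scope.
Local Open Scope ring_scope.

(* The complex numbers, packaged as a [numClosedFieldType] so that they carry
   the norm topology that the analysis library puts on such fields. *)
Definition complexField (R : realType) : numClosedFieldType := R[i].

(* (a)_k *)
Definition poch (K : pzRingType) (a : K) (k : nat) : K :=
  \prod_(1 <= j < k.+1) (a + j%:R - 1).

(* The k-th Taylor coefficient of pFq.  Read as a sequence, it is pFq as a
   formal power series, which makes sense for all p and q. *)
Definition hyp_coef (K : fieldType) (p q : nat) (a : 'I_p -> K) (b : 'I_q -> K)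
    (k : nat) : K :=
  (\prod_(i < p) poch (a i) k) / ((\prod_(j < q) poch (b j) k) * (k`!)%:R).

(* pFq as a function: the sum of the series, meaningful where it converges. *)
Definition hyp_fun (C : numFieldType) (p q : nat) (a : 'I_p -> C)
    (b : 'I_q -> C) (x : C) : C :=
  limn (series (fun k => hyp_coef a b k * x ^+ k)).

(* The open disc of convergence of the series: the whole plane if p <= q or if
   the series terminates, the unit disc if p = q + 1 and the series does not
   terminate, and empty otherwise. *)
Definition hyp_disc (C : numFieldType) (p q : nat) (a : 'I_p -> C)
    (b : 'I_q -> C) : set C :=
  [set x | exists2 z, `|x| < `|z| &
             cvgn (series (fun k => hyp_coef a b k * z ^+ k))].

(* The forbidden values of a denominator parameter. *)
Definition nonpos_int (K : pzRingType) (c : K) : Prop :=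
  exists m : nat, c = - m%:R.

Definition theta (C : numFieldType) (f : C -> C) : C -> C :=
  fun x => x * derive1 f x.

(* Formal power series are sequences of coefficients. *)
Definition fps_deriv (K : pzRingType) (f : nat -> K) : nat -> K :=
  fun k => k.+1%:R * f k.+1.

Definition fps_mulp (K : nzRingType) (r : {poly K}) (f : nat -> K) : nat -> K :=
  fun k => \sum_(i < k.+1) r`_i * f (k - i)%N.

Definition fps_theta (K : nzRingType) (f : nat -> K) : nat -> K :=
  fps_mulp 'X (fps_deriv f).

(* For an operator th, (th + c_1) (th + c_2) ... (th + c_m) f. *)
Definition op_prod (K : pzRingType) (V : lmodType K) (th : V -> V)
    (cs : seq K) (f : V) : V :=
  foldr (fun c g => th g + c *: g) f cs.

(* The two sides of the hypergeometric differential equation, the right-hand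
   side without its factor x. *)
Definition hyp_lhs (K : pzRingType) (V : lmodType K) (th : V -> V) (q : nat)
    (b : 'I_q -> K) (f : V) : V :=
  th (op_prod th [seq b j - 1 | j : 'I_q] f).

Definition hyp_rhs (K : pzRingType) (V : lmodType K) (th : V -> V) (p : nat)
    (a : 'I_p -> K) (f : V) : V :=
  op_prod th [seq a i | i : 'I_p] f.

(* Symbolic substitution of theta.  A shift expression sum_j c_j(n, x) F_(n+j),
   or sum_j c_j(n, x) F_(n-j), is the polynomial over {poly {poly K}} with
   coefficients c_j, in which 'X^j stands for F_(n+j), resp. F_(n-j); in the
   c_j themselves 'X is the variable x and 'Y is the parameter n.
   [subst_theta lam] applies theta to such an expression by the Leibniz rule,
   each theta F_(n+j) (resp. theta F_(n-j)) being replaced by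
   lam_j (F_(n+j+1) - F_(n+j)) (resp. lam_j (F_(n-j-1) - F_(n-j))). *)
Definition subst_theta (K : comNzRingType) (lam : nat -> {poly {poly K}})
    (e : {poly {poly {poly K}}}) : {poly {poly {poly K}}} :=
  \sum_(j < size e) (('X * (e`_j)^`()) *: 'X^j
                     + (e`_j * lam j) *: ('X^(j.+1) - 'X^j)).

(* The derivative rule at n + j for a numerator parameter n, and at n - j for a
   denominator parameter n. *)
Definition lam_num (K : comNzRingType) (j : nat) : {poly {poly K}} :=
  'Y + j%:R.
Definition lam_den (K : comNzRingType) (j : nat) : {poly {poly K}} :=
  'Y - j%:R - 1.

Definition cst2 (K : comNzRingType) (c : K) : {poly {poly K}} := (c%:P)%:P.

(* Left-hand side minus right-hand side of the differential equation after
   substitution; 1 = 'X^0 stands for F_n and the outer scalar 'X for x. *)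
Definition subst_num (K : comNzRingType) (p q : nat) (a : 'I_p -> K)
    (b : 'I_q -> K) (k : 'I_p) : {poly {poly {poly K}}} :=
  hyp_lhs (subst_theta (lam_num K)) (fun j => cst2 (b j)) 1
  - 'X *: hyp_rhs (subst_theta (lam_num K))
            [eta (fun i => cst2 (a i)) with k |-> 'Y] 1.

Definition subst_den (K : comNzRingType) (p q : nat) (a : 'I_p -> K)
    (b : 'I_q -> K) (k : 'I_q) : {poly {poly {poly K}}} :=
  hyp_lhs (subst_theta (lam_den K))
      [eta (fun j => cst2 (b j)) with k |-> 'Y] 1
  - 'X *: hyp_rhs (subst_theta (lam_den K)) (fun i => cst2 (a i)) 1.

(* The coefficients q_j of sum_(j <= m) q_j(n, x) F_(n-j) = 0 for m = max(p,q+1).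
   For a numerator parameter the substitution yields
   sum_(i <= m) c_i(n, x) F_(n+i) = 0, in which n is replaced by n - m. *)
Definition rec_num (K : comNzRingType) (p q : nat) (a : 'I_p -> K)
    (b : 'I_q -> K) (k : 'I_p) (j : nat) : {poly {poly K}} :=
  let m := maxn p q.+1 in
  map_poly (fun c : {poly K} => c \Po ('X - m%:R)) (subst_num a b k)`_(m - j).

Definition rec_den (K : comNzRingType) (p q : nat) (a : 'I_p -> K)
    (b : 'I_q -> K) (k : 'I_q) (j : nat) : {poly {poly K}} :=
  (subst_den a b k)`_j.

(* The polynomial r(n, x) in x obtained by giving a value to n. *)
Definition at_n (K : comNzRingType) (r : {poly {poly K}}) (n : K) : {poly K} :=
  map_poly (horner_eval n) r.

Definition shift_closed (K : pzRingType) (D : set K) : Prop :=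
  (forall n, D n -> D (n + 1)) \/ (forall n, D n -> D (n - 1)).

(* f_n'(x) = sum_(k < M) r_k(n, x) f_(n + s k)(x) on U, where
   r_k = num_k / den_k; s = 1 or s = -1 is the direction of the rule.  The rule
   is required for those n for which all its terms belong to the family. *)
Definition derivative_rule (C : numFieldType) (D U : set C) (f : C -> C -> C)
    (s : C) : Prop :=
  exists M : nat, exists num den : nat -> C -> {poly C},
    (forall k n, den k n != 0) /\
    forall n x, D n -> (forall k, (k < M)%N -> D (n + s * k%:R)) ->
      U x -> (forall k, (k < M)%N -> (den k n).[x] != 0) ->
      derivable (f n) x 1 /\
      derive1 (f n) x =
        \sum_(k < M) (num k n).[x] / (den k n).[x] * f (n + s * k%:R) x.

Definition recurrence (C : numFieldType) (D U : set C) (f : C -> C -> C)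
    (m : nat) : Prop :=
  exists q : nat -> C -> {poly C},
    [/\ forall n x, (forall k, (k <= m)%N -> D (n - k%:R)) -> U x ->
          \sum_(k < m.+1) (q k n).[x] * f (n - k%:R) x = 0,
        exists2 n, (forall k, (k <= m)%N -> D (n - k%:R)) & q 0%N n != 0
      & exists2 n, (forall k, (k <= m)%N -> D (n - k%:R)) & q m n != 0].

(* The functions (f_n)_(n in D), considered on the set U, form an admissible
   family of order m. *)
Definition admissible (C : numFieldType) (D U : set C) (f : C -> C -> C)
    (m : nat) : Prop :=
  [/\ shift_closed D,
      derivative_rule D U f (- 1) \/ derivative_rule D U f 1
    & recurrence D U f m].

(* The same notions for families of formal power series; the rational functions
   of the derivative rule are brought to a common denominator den. *)
Definition fps_derivative_rule (K : fieldType) (D : set K)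
    (f : K -> nat -> K) (s : K) : Prop :=
  exists M : nat, exists (num : nat -> K -> {poly K}) (den : K -> {poly K}),
    (forall n, den n != 0) /\
    forall n, D n -> (forall k, (k < M)%N -> D (n + s * k%:R)) ->
      fps_mulp (den n) (fps_deriv (f n)) =
        \sum_(k < M) fps_mulp (num k n) (f (n + s * k%:R)).

Definition fps_recurrence (K : fieldType) (D : set K) (f : K -> nat -> K)
    (m : nat) : Prop :=
  exists q : nat -> K -> {poly K},
    [/\ forall n, (forall k, (k <= m)%N -> D (n - k%:R)) ->
          \sum_(k < m.+1) fps_mulp (q k n) (f (n - k%:R)) = 0,
        exists2 n, (forall k, (k <= m)%N -> D (n - k%:R)) & q 0%N n != 0
      & exists2 n, (forall k, (k <= m)%N -> D (n - k%:R)) & q m n != 0].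

Definition fps_admissible (K : fieldType) (D : set K) (f : K -> nat -> K)
    (m : nat) : Prop :=
  [/\ shift_closed D,
      fps_derivative_rule D f (- 1) \/ fps_derivative_rule D f 1
    & fps_recurrence D f m].

(* Main.v *)
Require Import Defs.
From HB Require Import structures.
From mathcomp Require Import all_boot all_order all_algebra.
From mathcomp Require Import complex.
From mathcomp Require Import all_classical all_reals all_analysis.
From mathcomp Require Import ring.

Set Implicit Arguments.
Unset Strict Implicit.
Unset Printing Implicit Defensive.

Import Order.TTheory GRing.Theory Num.Theory numFieldNormedType.Exports.
Local Open Scope classical_set_scope.
Local Open Scope ring_scope.

(** Everything rests on how theta and the parameter shifts act on Taylor
    coefficients.  Since theta multiplies the k-th coefficient by k, an operator
    theta + c multiplies it by k + c, and the differential equation says no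
    more than what the quotient of two consecutive coefficients of pFq is
    ([fps_hyp_ode]).  In the same way both derivative rules reduce to
    n (n+1)_k = (n+k) (n)_k ([poch_shift]), applied to n for a numerator
    parameter and to n - 1 for a denominator parameter.

    For the recurrence equation, a shift expression is read as a combination of
    the series F_(n+j) or F_(n-j) ([seval]).  The Leibniz rule and the derivative
    rule make the symbolic substitution commute with theta
    ([seval_subst_theta]), so the substituted differential equation evaluates to
    the true one, that is, to 0.  For a denominator parameter the derivative
    rule at n - j needs F_(n-j-1) to be defined; as each theta raises the degree
    of the expression by at most one, only the shifts up to max(p, q+1) are ever
    used, which is all that the hypothesis on n provides.

    The order is read off the two extreme coefficients.  The highest one is
    prod_(j < m) lambda_j times 1, - x or 1 - x, according to which side of the
    equation has more factors, hence not 0.  For the lowest one, theta + c acts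
    on F_n as the scalar c - lambda_0; on the side that contains the chosen
    parameter one of these scalars is 0, on the other side none is.  Both
    coefficients therefore survive for all but finitely many n, and a
    shift-closed set is infinite.

    The statements on functions follow from those on formal series.  A power
    series that converges at z is differentiable termwise for |x| < |z|
    ([psum_derivable]); the recurrence only needs that evaluation at a point
    of convergence is linear and compatible with multiplication by polynomials
    ([psum_recurrence]). *)

(** * Absolute convergence in the complex numbers *)

(** Completeness in the only form that power series need; it lets the analysis
    below be carried out over any numeric field. *)
Definition abs_complete (C : numFieldType) : Prop :=
  forall (u : C^nat) (M : C),
    (forall n, \sum_(k < n) `|u k| <= M) -> cvgn (series u).

(** The real and imaginary parts are dominated by the modulus, so both series
    of parts converge absolutely in R. *)
Lemma complex_abs_complete (R : realType) : abs_complete (complexField R).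
Proof.
move=> u M uM.
have part_cvg (g : R[i] -> R) :
    (forall z : R[i], real_complex R `|g z| <= `|z|) -> cvgn (series (g \o u)).
  move=> g_le; apply: normed_cvg; apply: nondecreasing_is_cvgn.
    by apply: nondecreasing_series => n _ _; exact: normr_ge0.
  exists (complex.Re M) => _ [n _ <-].
  have : real_complex R (\sum_(k < n) `|g (u k)|) <= M.
    rewrite rmorph_sum; apply: le_trans (uM n).
    by apply: ler_sum => k _; exact: g_le.
  rewrite lecE => /andP[_]; rewrite /= /series /= big_mkord; exact.
have im_le (z : R[i]) : real_complex R `|complex.Im z| <= `|z|.
  rewrite normc_def lecR -sqrtr_sqr ler_wsqrtr //.
  by rewrite lerDr sqr_ge0.
have [l ul] : exists l : R, series (@complex.Re R \o u) @ \oo --> l.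
  by apply/cvg_ex; apply: part_cvg => z; exact: normc_ge_Re.
have [m um] : exists m : R, series (@complex.Im R \o u) @ \oo --> m.
  by apply/cvg_ex; apply: part_cvg.
apply/cvg_ex; exists (Complex l m); apply/cvgrPdist_lt => eps eps0.
(* In the order of R[i] a positive number is real. *)
have epsE : eps = real_complex R (complex.Re eps).
  by rewrite RRe_real // gtr0_real.
have e0 : 0 < complex.Re eps by rewrite epsE ltcR in eps0.
near=> n; rewrite epsE.
have -> : series u n = Complex (series (@complex.Re R \o u) n) (series (@complex.Im R \o u) n).
  rewrite /series /=; elim/big_rec3: _ => // k x y z _ ->.
  by case: (u k).
have lt1 : `|l - series (@complex.Re R \o u) n| < complex.Re eps / 2.
  by near: n; apply: cvgr_dist_lt => //; rewrite divr_gt0.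
have lt2 : `|m - series (@complex.Im R \o u) n| < complex.Re eps / 2.
  by near: n; apply: cvgr_dist_lt => //; rewrite divr_gt0.
rewrite normc_def ltcR /=.
set a := _ - _ in lt1 *; set b := _ - _ in lt2 *.
apply: (@le_lt_trans _ _ (`|a| + `|b|)); last by rewrite (splitr (complex.Re eps)) ltrD.
rewrite -(ger0_norm (addr_ge0 (normr_ge0 a) (normr_ge0 b))) -(sqrtr_sqr (`|a| + `|b|)).
rewrite ler_wsqrtr // [leRHS]sqrrD !real_normK ?num_real //.
by rewrite addrAC lerDl mulrn_wge0// mulr_ge0.
Unshelve. all: by end_near.
Qed.

(** * Formal power series and the Pochhammer symbol *)

Section FormalPowerSeries.
Variable K : numFieldType.
Implicit Types (r s : {poly K}) (f g : nat -> K) (c : K).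

Lemma fpsE :
  ((forall f g k, ((f + g) k = f k + g k)%R) *
   (forall f k, ((- f) k = - f k)%R) *
   (forall c f k, ((c *: f) k = c * f k)%R))%type.
Proof. by []. Qed.

Lemma fps_mulpDl r s f : fps_mulp (r + s) f = fps_mulp r f + fps_mulp s f.
Proof.
apply/funext => k; rewrite ?fpsE /fps_mulp -big_split /=.
by apply: eq_bigr => i _; rewrite coefD mulrDl.
Qed.

Lemma fps_mulpZl c r f : fps_mulp (c *: r) f = c *: fps_mulp r f.
Proof.
apply/funext => k; rewrite ?fpsE /fps_mulp mulr_sumr.
by apply: eq_bigr => i _; rewrite coefZ -mulrA.
Qed.

Lemma fps_mulp0l f : fps_mulp 0 f = 0.
Proof. by rewrite -[X in fps_mulp X f](scale0r (0 : {poly K})) fps_mulpZl scale0r. Qed.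

Lemma fps_mulpC c f : fps_mulp c%:P f = c *: f.
Proof.
apply/funext => k; rewrite ?fpsE /fps_mulp big_ord_recl coefC eqxx subn0.
by rewrite big1 ?addr0 // => i _; rewrite coefC mul0r.
Qed.

Lemma fps_mulpDr r f g : fps_mulp r (f + g) = fps_mulp r f + fps_mulp r g.
Proof.
apply/funext => k; rewrite ?fpsE /fps_mulp -big_split /=.
by apply: eq_bigr => i _; rewrite fpsE mulrDr.
Qed.

Lemma fps_mulpZr r c f : fps_mulp r (c *: f) = c *: fps_mulp r f.
Proof.
apply/funext => k; rewrite ?fpsE /fps_mulp mulr_sumr.
by apply: eq_bigr => i _; rewrite fpsE mulrCA.
Qed.

Lemma fps_mulp0r r : fps_mulp r 0 = 0.
Proof. by rewrite -[X in fps_mulp r X](scale0r 0) fps_mulpZr scale0r. Qed.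

Lemma fps_mulpBr r f g : fps_mulp r (f - g) = fps_mulp r f - fps_mulp r g.
Proof. by rewrite -scaleN1r fps_mulpDr fps_mulpZr scaleN1r. Qed.

Lemma fps_mulpXE f k :
  fps_mulp 'X f k = if k is k'.+1 then f k' else 0.
Proof.
rewrite /fps_mulp big_ord_recl coefX mul0r add0r.
case: k => [|k]; first by rewrite big_ord0.
rewrite big_ord_recl coefX mul1r /= subn1 big1 ?addr0 // => i _.
by rewrite coefX mul0r.
Qed.

Lemma fps_mulpXM r f : fps_mulp ('X * r) f = fps_mulp 'X (fps_mulp r f).
Proof.
apply/funext => k; rewrite fps_mulpXE /fps_mulp big_ord_recl coefXM mul0r add0r.
case: k => [|k]; first by rewrite big_ord0.
by apply: eq_bigr => i _; rewrite coefXM.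
Qed.

Lemma fps_thetaE f k : fps_theta f k = k%:R * f k.
Proof. by rewrite /fps_theta fps_mulpXE; case: k => [|k]; rewrite ?mul0r. Qed.

(** The weight k of a coefficient splits as i + (k - i) in each term of the
    Cauchy product: this is the Leibniz rule. *)
Lemma fps_theta_mulp r f :
  fps_theta (fps_mulp r f) = fps_mulp ('X * r^`()) f + fps_mulp r (fps_theta f).
Proof.
apply/funext => k; rewrite fps_thetaE fpsE /fps_mulp -big_split mulr_sumr.
apply: eq_bigr => i _ /=; rewrite fps_thetaE.
have -> : ('X * r^`())`_i = r`_i *+ i.
  by rewrite coefXM coef_deriv; case: (i : nat) => [|j]; rewrite /= ?mulr0n.
rewrite -[in k%:R](subnK (leq_ord i)) natrD -[r`_i *+ i]mulr_natr.
by rewrite mulrDl addrC -mulrA mulrCA; congr (_ + _); rewrite mulrCA.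
Qed.

Lemma fps_thetaD f g : fps_theta (f + g) = fps_theta f + fps_theta g.
Proof. by apply/funext => k; rewrite fpsE !fps_thetaE fpsE mulrDr. Qed.

Lemma fps_theta0 : fps_theta (0 : nat -> K) = 0.
Proof. by apply/funext => k; rewrite fps_thetaE mulr0. Qed.

(** theta + c is diagonal on coefficients, so the factors of the two sides of
    the differential equation can be compared one coefficient at a time. *)
Lemma op_prod_fpsE (cs : seq K) f k :
  op_prod (@fps_theta K) cs f k = (\prod_(c <- cs) (k%:R + c)) * f k.
Proof.
elim: cs => [|c cs IH] /=; first by rewrite big_nil mul1r.
by rewrite fpsE fps_thetaE big_cons -mulrA mulrDl -IH.
Qed.

Lemma poch0 c : poch c 0 = 1.
Proof. by rewrite /poch big_geq. Qed.

Lemma pochS c k : poch c k.+1 = poch c k * (c + k%:R).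
Proof.
rewrite /poch big_nat_recr //=; congr (_ * _).
by rewrite -[k.+1%:R]natr1 addrA addrK.
Qed.

Lemma pochSl c k : poch c k.+1 = c * poch (c + 1) k.
Proof.
elim: k => [|k IH]; first by rewrite pochS !poch0 mul1r mulr1 addr0.
by rewrite pochS IH pochS -mulrA -natr1 addrA addrAC.
Qed.

(** Both sides are (c)_(k+1), peeled off at either end; the two derivative rules
    come from this identity. *)
Lemma poch_shift c k : c * poch (c + 1) k = (c + k%:R) * poch c k.
Proof. by rewrite -pochSl pochS mulrC. Qed.

End FormalPowerSeries.

Section HypergeometricSeries.
Variable K : numFieldType.
Implicit Types (c n : K).

Lemma poch_neq0 c k : ~ nonpos_int c -> poch c k != 0.
Proof.
move=> cN; elim: k => [|k IH]; first by rewrite poch0 oner_eq0.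
rewrite pochS mulf_neq0 //; apply/eqP => ck; apply: cN; exists k.
by apply/eqP; rewrite -subr_eq0 opprK ck.
Qed.

Lemma hyp_coefS p q (a : 'I_p -> K) (b : 'I_q -> K) k :
  hyp_coef a b k.+1 = hyp_coef a b k *
    ((\prod_i (a i + k%:R)) / ((\prod_j (b j + k%:R)) * k.+1%:R)).
Proof.
have prodS m (c : 'I_m -> K) : \prod_i poch (c i) k.+1 =
    \prod_i poch (c i) k * \prod_i (c i + k%:R).
  by rewrite -big_split; apply: eq_bigr => i _; rewrite pochS.
rewrite /hyp_coef factS natrM !prodS [RHS]mulrACA -invfM; congr (_ / _).
by rewrite [RHS]mulrACA [k.+1%:R * _]mulrC.
Qed.

(** The products of (k + b_j) and (k + a_i) brought out by the operators are the
    denominator and the numerator of the quotient of two consecutive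
    coefficients. *)
Lemma fps_hyp_ode p q (a : 'I_p -> K) (b : 'I_q -> K) :
    (forall j, ~ nonpos_int (b j)) ->
  hyp_lhs (@fps_theta K) b (hyp_coef a b) =
  fps_mulp 'X (hyp_rhs (@fps_theta K) a (hyp_coef a b)).
Proof.
move=> hb; apply/funext => k.
rewrite /hyp_lhs /hyp_rhs fps_thetaE fps_mulpXE.
case: k => [|k]; first by rewrite mul0r.
rewrite !op_prod_fpsE !big_image hyp_coefS /=.
have -> : \prod_(j in 'I_q) (k.+1%:R + (b j - 1)) = \prod_j (b j + k%:R).
  by apply: eq_bigr => j _; rewrite -natr1; ring.
have -> : \prod_(i in 'I_p) (k%:R + a i) = \prod_i (a i + k%:R).
  by apply: eq_bigr => j _; rewrite addrC.
have B0 : \prod_j (b j + k%:R) != 0.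
  apply/prodf_neq0 => j _; apply/eqP => bk; apply: (hb j); exists k.
  by apply/eqP; rewrite -subr_eq0 opprK bk.
have k0 : k.+1%:R != 0 :> K by rewrite pnatr_eq0.
move: (\prod_(j < q) _) B0 (k.+1%:R) k0 => B B0 s s0.
by field; rewrite s0 B0.
Qed.

Lemma prod_poch_with m (c : 'I_m -> K) (k : 'I_m) n j :
  \prod_i poch ([eta c with k |-> n] i) j =
  poch n j * \prod_(i < m | i != k) poch (c i) j.
Proof.
rewrite (bigD1 k) //= eqxx; congr (_ * _).
by apply: eq_bigr => i /negPf ->.
Qed.

Lemma fps_theta_num p q (a : 'I_p -> K) (b : 'I_q -> K) (k : 'I_p) n :
  let G := fun n => hyp_coef [eta a with k |-> n] b in
  fps_theta (G n) = n *: (G (n + 1) - G n).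
Proof.
move=> G; apply/funext => j; rewrite fps_thetaE !fpsE /G /hyp_coef.
rewrite !prod_poch_with; move: (\prod_(i < p | _) _) (_^-1) => A v.
have -> : forall x y, n * (x * A * v - y * A * v) = (n * x - n * y) * A * v.
  by move=> x y; ring.
by rewrite poch_shift; ring.
Qed.

(** The shifts to n and n - 1 occur in denominators, so neither Pochhammer
    symbol may vanish. *)
Lemma fps_theta_den p q (a : 'I_p -> K) (b : 'I_q -> K) (k : 'I_q) n :
    ~ nonpos_int n -> ~ nonpos_int (n - 1) ->
  let G := fun n => hyp_coef a [eta b with k |-> n] in
  fps_theta (G n) = (n - 1) *: (G (n - 1) - G n).
Proof.
move=> n0 n1 G; apply/funext => j; rewrite fps_thetaE !fpsE /G /hyp_coef.
rewrite !prod_poch_with !invfM.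
move: (\prod_(i < p) _) (\prod_(i < q | _) _)^-1 (_`!%:R^-1) => A u v.
have shift : (n - 1) * (poch (n - 1) j)^-1 = (n - 1 + j%:R) * (poch n j)^-1.
  have P0 := poch_neq0 j n0; have P1 := poch_neq0 j n1.
  apply: (mulIf P0); apply: (mulIf P1); rewrite !mulfVK //.
  have := poch_shift (n - 1) j; rewrite subrK => <-.
  by field; rewrite P1.
have -> : forall x y, (n - 1) * (A * (x * u * v) - A * (y * u * v)) =
    ((n - 1) * x - (n - 1) * y) * A * u * v.
  by move=> x y; ring.
by rewrite shift; ring.
Qed.

End HypergeometricSeries.

(** * Sums of power series *)

Section PowerSeries.
Variable C : numFieldType.
Implicit Types (c d : nat -> C) (x y z r : C).

Definition pterm c x : nat -> C := fun k => c k * x ^+ k.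

Definition pcvg c x : Prop := cvgn (series (pterm c x)).

Definition psum c x : C := limn (series (pterm c x)).

Lemma ptermD c d x : pterm (c + d) x = pterm c x + pterm d x.
Proof. by apply/funext => k; rewrite /pterm !fpsE mulrDl. Qed.

Lemma ptermZ a c x : pterm (a *: c) x = a *: pterm c x.
Proof. by apply/funext => k; rewrite /pterm !fpsE mulrA. Qed.

Lemma pcvgD c d x : pcvg c x -> pcvg d x -> pcvg (c + d) x.
Proof. by rewrite /pcvg ptermD; exact: is_cvg_seriesD. Qed.

Lemma psumD c d x : pcvg c x -> pcvg d x -> psum (c + d) x = psum c x + psum d x.
Proof. by rewrite /psum ptermD; exact: lim_seriesD. Qed.

Lemma pcvgZ a c x : pcvg c x -> pcvg (a *: c) x.
Proof. by rewrite /pcvg ptermZ; exact: is_cvg_seriesZ. Qed.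

Lemma psumZ a c x : pcvg c x -> psum (a *: c) x = a * psum c x.
Proof. by rewrite /psum ptermZ; exact: lim_seriesZ. Qed.

Lemma psum0 x : pcvg 0 x /\ psum 0 x = 0.
Proof.
have s0 : series (pterm 0 x) = cst 0.
  by apply/funext => n; rewrite /series /= big1 // => k _; rewrite /pterm mul0r.
by rewrite /pcvg /psum s0; split; [exact: is_cvg_cst | exact: lim_cst].
Qed.

Lemma psumB c d x : pcvg c x -> pcvg d x -> psum (c - d) x = psum c x - psum d x.
Proof.
move=> cx dx; rewrite -scaleN1r psumD ?psumZ ?mulN1r //; exact: pcvgZ.
Qed.

Lemma psum_sum m (c : 'I_m -> nat -> C) x : (forall j, pcvg (c j) x) ->
  psum (\sum_j c j) x = \sum_j psum (c j) x.
Proof.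
move=> cx; suff [] : pcvg (\sum_j c j) x /\
  psum (\sum_j c j) x = \sum_j psum (c j) x by [].
elim/big_rec2: _ => [|j d e _ [IH <-]]; first exact: psum0.
by split; [exact: pcvgD | exact: psumD].
Qed.

Lemma series_shift c x n :
  series (pterm (fps_mulp 'X c) x) n.+1 = x * series (pterm c x) n.
Proof.
rewrite /series /= big_nat_recl //= /pterm fps_mulpXE mul0r add0r mulr_sumr.
by apply: eq_bigr => k _; rewrite fps_mulpXE exprS mulrCA.
Qed.

Lemma psumX c x : pcvg c x ->
  pcvg (fps_mulp 'X c) x /\ psum (fps_mulp 'X c) x = x * psum c x.
Proof.
move=> cx.
suff cv : series (pterm (fps_mulp 'X c) x) @ \oo --> x * psum c x.
  by split; [apply/cvg_ex; eexists; exact: cv | exact: cvg_lim cv].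
rewrite -cvg_shiftS; under eq_fun do rewrite series_shift.
exact: cvgMr cx.
Qed.

(** Through this lemma identities between formal series become identities between
    their sums; by induction on p only the shift by 'X has to be treated. *)
Lemma psum_mulp (p : {poly C}) c x : pcvg c x ->
  pcvg (fps_mulp p c) x /\ psum (fps_mulp p c) x = p.[x] * psum c x.
Proof.
move=> cx; elim/poly_ind: p => [|p a [IH1 IH2]].
  by rewrite fps_mulp0l horner0 mul0r; exact: psum0.
have [X1 X2] := psumX IH1.
rewrite hornerMXaddC [p * 'X]mulrC fps_mulpDl fps_mulpXM fps_mulpC.
split; first by apply: pcvgD => //; exact: pcvgZ.
rewrite psumD //; last exact: pcvgZ.
by rewrite X2 IH2 psumZ // mulrA [x * _]mulrC -mulrDl.
Qed.

End PowerSeries.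

(** * Termwise differentiation in the disc of convergence *)

Section DiscOfConvergence.
Variable C : numFieldType.
Implicit Types (c : nat -> C) (f : C -> C) (x y z r t rho : C).

(** Multiplication by 1 - t lowers the order of the binomial series
    sum_k binomial(k + d, d) t^k = (1 - t)^-(d+1); iterated, this bounds its
    partial sums without any limit. *)
Lemma binom_series_rec d n t :
  (1 - t) * (\sum_(k < n) 'C(k + d.+1, d.+1)%:R * t ^+ k) =
  \sum_(k < n) 'C(k + d, d)%:R * t ^+ k - 'C(n + d, d.+1)%:R * t ^+ n.
Proof.
elim: n => [|n IH]; first by rewrite !big_ord0 mulr0 add0n bin_small // mul0r subr0.
rewrite !big_ord_recr /= mulrDr IH addnS addSn binS natrD exprS; ring.
Qed.

Lemma binom_series_le d n t : 0 <= t -> t < 1 ->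
  \sum_(k < n) 'C(k + d, d)%:R * t ^+ k <= (1 - t)^-1 ^+ d.+1.
Proof.
move=> t0 t1; have u0 : 0 < 1 - t by rewrite subr_gt0.
elim: d => [|d IH].
  rewrite expr1 -(ler_pM2l u0) mulfV ?gt_eqF //.
  have -> : (1 - t) * (\sum_(k < n) 'C(k + 0, 0)%:R * t ^+ k) = 1 - t ^+ n.
    elim: n => [|n IH]; first by rewrite big_ord0 mulr0 subrr.
    by rewrite big_ord_recr /= mulrDr IH bin0 exprS; ring.
  by rewrite lerBlDr lerDl exprn_ge0.
rewrite -(ler_pM2l u0) binom_series_rec [in leRHS]exprS mulVKf ?gt_eqF //.
by apply: le_trans IH; rewrite lerBlDr lerDl mulr_ge0 // exprn_ge0.
Qed.

Lemma binom_sum_le_bound (u : nat -> C) d M t : 0 <= t -> t < 1 -> 0 <= M ->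
    (forall k, `|u k| <= M * ('C(k + d, d)%:R * t ^+ k)) ->
  forall n, \sum_(k < n) `|u k| <= M * (1 - t)^-1 ^+ d.+1.
Proof.
move=> t0 t1 M0 uM n; apply: (@le_trans _ _ (\sum_(k < n) M * ('C(k + d, d)%:R * t ^+ k))).
  by apply: ler_sum => k _; exact: uM.
by rewrite -mulr_sumr ler_wpM2l // binom_series_le.
Qed.

(** Unlike convergence on a disc, this growth condition is visibly preserved by
    theta, so it can be carried through iterated derivatives. *)
Definition disc_bounded c r : Prop :=
  forall rho, 0 < rho -> rho < r ->
  exists2 M, 0 <= M & forall k, `|c k| * rho ^+ k <= M.

Lemma pcvg_disc_bounded c z : pcvg c z -> disc_bounded c `|z|.
Proof.
move=> /cvg_series_cvg_0 cz rho rho0 rhoz.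
have [M M0 cM] : exists2 M, 0 <= M & forall k, `|pterm c z k| <= M.
  have /cvg_seq_bounded : cvgn (pterm c z) by apply/cvg_ex; exists 0.
  by move=> /pinfty_ex_gt0[M M0 MP]; exists M => [|k]; [exact: ltW | exact: MP].
exists M => // k; apply: le_trans (cM k); rewrite /pterm normrM normrX.
by rewrite ler_wpM2l // lerXn2r ?nnegrE // ltW.
Qed.

(** A radius rho strictly between |x| and r gives |x|^k = rho^k t^k with t < 1:
    the growth condition at rho turns into geometric decay at x. *)
Lemma disc_bounded_geom c r x : disc_bounded c r -> `|x| < r ->
  exists rho M t, [/\ 0 < rho, 0 <= M, 0 <= t < 1, `|x| = rho * t &
    forall k, `|c k| * rho ^+ k <= M].
Proof.
move=> cr xr.
have x0 := normr_ge0 x.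
pose rho := (`|x| + r) / 2.
have rx : `|x| < rho by rewrite /rho midf_lt.
have rr : rho < r by rewrite /rho midf_lt.
have rho0 : 0 < rho by apply: le_lt_trans rx.
have [M M0 cM] := cr rho rho0 rr.
exists rho, M, (`|x| / rho); split=> //.
- by rewrite divr_ge0 ?ltr_pdivrMr ?mul1r // ltW.
- by rewrite mulrC divfK // gt_eqF.
Qed.

Lemma disc_bounded_deriv c r : disc_bounded c r -> disc_bounded (fps_deriv c) r.
Proof.
move=> cr s s0 sr.
have s_norm : `|s| = s by rewrite gtr0_norm.
have snr : `|s| < r by rewrite s_norm.
have [rho [M [t [rho0 M0 /andP[t0 t1] sE cM]]]] := disc_bounded_geom cr snr.
rewrite s_norm in sE.
pose B := M / rho * (1 - t)^-1 ^+ 2.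
have MB : 0 <= M / rho by rewrite divr_ge0 // ltW.
have dB k : `|fps_deriv c k * s ^+ k| <= M / rho * ('C(k + 1, 1)%:R * t ^+ k).
  rewrite /fps_deriv bin1 addn1 normrM normrM normr_nat normrX s_norm sE.
  have -> : k.+1%:R * `|c k.+1| * (rho * t) ^+ k =
      (`|c k.+1| * rho ^+ k.+1) * (k.+1%:R * t ^+ k) / rho.
    by rewrite exprMn exprS; field; rewrite gt_eqF.
  rewrite [leRHS]mulrAC ler_wpM2r ?invr_ge0 ?(ltW rho0) // ler_wpM2r //.
  by rewrite mulr_ge0 // exprn_ge0.
exists B; first by rewrite mulr_ge0 // exprn_ge0 // invr_ge0 subr_ge0 ltW.
move=> k; have -> : `|fps_deriv c k| * s ^+ k = `|fps_deriv c k * s ^+ k|.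
  by rewrite [RHS]normrM normrX s_norm.
apply: le_trans (binom_sum_le_bound t0 t1 MB dB k.+1).
by rewrite big_ord_recr /= lerDr sumr_ge0.
Qed.

Lemma disc_boundedX c r : disc_bounded c r -> disc_bounded (fps_mulp 'X c) r.
Proof.
move=> cr s s0 sr; have [M M0 cM] := cr s s0 sr.
have sM0 : 0 <= s * M by rewrite mulr_ge0 // ltW.
exists (s * M) => // k; rewrite fps_mulpXE.
case: k => [|k]; first by rewrite normr0 mul0r.
by rewrite exprS mulrCA ler_wpM2l // ltW.
Qed.

Lemma disc_bounded_theta c r : disc_bounded c r -> disc_bounded (fps_theta c) r.
Proof. by move=> cr; apply: disc_boundedX; exact: disc_bounded_deriv. Qed.

Lemma disc_boundedD c d r : disc_bounded c r -> disc_bounded d r -> disc_bounded (c + d) r.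
Proof.
move=> cr dr s s0 sr; have [M M0 cM] := cr s s0 sr; have [N N0 dN] := dr s s0 sr.
exists (M + N) => [|k]; first exact: addr_ge0.
apply: le_trans (lerD (cM k) (dN k)); rewrite -mulrDl fpsE.
by rewrite ler_wpM2r ?ler_normD // exprn_ge0 // ltW.
Qed.

Lemma disc_boundedZ a c r : disc_bounded c r -> disc_bounded (a *: c) r.
Proof.
move=> cr s s0 sr; have [M M0 cM] := cr s s0 sr.
exists (`|a| * M) => [|k]; first exact: mulr_ge0.
by rewrite fpsE normrM -mulrA ler_wpM2l.
Qed.

Hypothesis Ccomplete : abs_complete C.

Lemma disc_bounded_pcvg c r x : disc_bounded c r -> `|x| < r -> pcvg c x.
Proof.
move=> cr xr; have [rho [M [t [rho0 M0 /andP[t0 t1] xE cM]]]] := disc_bounded_geom cr xr.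
apply: (Ccomplete (M := M * (1 - t)^-1 ^+ 1)).
apply: binom_sum_le_bound => // k.
rewrite /pterm bin0 mul1r normrM normrX xE exprMn mulrA.
by rewrite ler_wpM2r // exprn_ge0.
Qed.

(** The remainder E_k of the linear approximation of x^k satisfies
    E_(k+1) = (x + h) E_k + k h^2 x^(k-1), and Pascal's rule matches this with
    the bound. *)
Lemma taylor2_le x h s k : `|x| <= s -> `|x + h| <= s ->
  `|(x + h) ^+ k.+2 - x ^+ k.+2 - h * (k.+2%:R * x ^+ k.+1)| <=
  `|h| ^+ 2 * ('C(k + 2, 2)%:R * s ^+ k).
Proof.
move=> xs yx; have s0 : 0 <= s by apply: le_trans xs.
elim: k => [|k IH].
  have -> : (x + h) ^+ 2 - x ^+ 2 - h * (2 * x ^+ 1) = h ^+ 2 by ring.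
  by rewrite normrX add0n binn mulr1 mulr1.
have -> : (x + h) ^+ k.+3 - x ^+ k.+3 - h * (k.+3%:R * x ^+ k.+2) =
    (x + h) * ((x + h) ^+ k.+2 - x ^+ k.+2 - h * (k.+2%:R * x ^+ k.+1)) +
    h ^+ 2 * (k.+2%:R * x ^+ k.+1).
  by rewrite !exprS -[k.+3%:R]natr1; ring.
have -> : `|h| ^+ 2 * ('C(k.+1 + 2, 2)%:R * s ^+ k.+1) =
    s * (`|h| ^+ 2 * ('C(k + 2, 2)%:R * s ^+ k)) +
    `|h| ^+ 2 * (k.+2%:R * s ^+ k.+1).
  by rewrite addSn binS bin1 addn2 natrD !exprS; ring.
apply: le_trans (ler_normD _ _) _; apply: lerD.
  by rewrite normrM ler_pM.
rewrite normrM normrX [X in _ * X]normrM normr_nat normrX.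
by rewrite !ler_wpM2l ?exprn_ge0 // lerXn2r ?nnegrE.
Qed.

Lemma lim_norm_le (u : nat -> C) (l B : C) :
  u @ \oo --> l -> (forall n, `|u n| <= B) -> `|l| <= B.
Proof.
move=> ul uB; apply/ler_addgt0Pr => e e0.
have [N _ NP] : \forall n \near \oo, `|l - u n| <= e by apply: cvgr_dist_le.
have := NP N (leqnn N) => /= lN.
rewrite -(subrK (u N) l) addrC; apply: le_trans (ler_normD _ _) _.
exact: lerD.
Qed.

(** The derivative series has one term less than the series itself, and the
    terms of degree 0 and 1 leave no remainder. *)
Lemma partial_sum_taylor c x h n :
  series (pterm c (x + h)) n.+2 - series (pterm c x) n.+2
  - h * series (pterm (fps_deriv c) x) n.+1 =
  \sum_(k < n) c k.+2 *
    ((x + h) ^+ k.+2 - x ^+ k.+2 - h * (k.+2%:R * x ^+ k.+1)).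
Proof.
elim: n => [|n IH].
  rewrite big_ord0 /series /= !big_nat_recr //= !big_geq // /pterm /fps_deriv.
  by rewrite expr0; ring.
rewrite big_ord_recr /= -IH.
rewrite [series (pterm c (x + h)) n.+3]seriesSr [series (pterm c x) n.+3]seriesSr.
rewrite [series (pterm (fps_deriv c) x) n.+2]seriesSr.
move: (series _ _) (series _ _) (series _ _) => sy sx sd.
by rewrite /pterm /fps_deriv; ring.
Qed.

(** Summing [taylor2_le] gives a remainder O(h^2), uniform in the number of
    terms: the weights binomial(k + 2, 2) are absorbed by the geometric decay. *)
Lemma psum_taylor_le c r x : disc_bounded c r -> `|x| < r ->
  exists2 B, 0 <= B & exists2 delta, 0 < delta &
  forall h, `|h| < delta ->
    `|psum c (x + h) - psum c x - h * psum (fps_deriv c) x| <= `|h| ^+ 2 * B.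
Proof.
move=> cr xr; pose s := (`|x| + r) / 2.
have xs : `|x| < s by rewrite /s midf_lt.
have sr : s < r by rewrite /s midf_lt.
have s0 : 0 < s by apply: le_lt_trans xs.
have s_norm : `|s| = s by rewrite gtr0_norm.
have snr : `|s| < r by rewrite s_norm.
have [rho [M [t [rho0 M0 /andP[t0 t1] sE cM]]]] := disc_bounded_geom cr snr.
rewrite s_norm in sE.
have MB : 0 <= M / rho ^+ 2 by rewrite divr_ge0 // exprn_ge0 // ltW.
exists (M / rho ^+ 2 * (1 - t)^-1 ^+ 3).
  by rewrite mulr_ge0 // exprn_ge0 // invr_ge0 subr_ge0 ltW.
exists (s - `|x|); first by rewrite subr_gt0.
move=> h hs.
have yx : `|x + h| < s.
  by apply: le_lt_trans (ler_normD _ _) _; rewrite addrC -ltrBrDr.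
have cvx := disc_bounded_pcvg cr xr.
have cvy : pcvg c (x + h) by apply: disc_bounded_pcvg cr _; exact: lt_trans sr.
have cvd : pcvg (fps_deriv c) x.
  by apply: disc_bounded_pcvg xr; exact: disc_bounded_deriv.
have lim_taylor : (fun n => series (pterm c (x + h)) n.+2 - series (pterm c x) n.+2
    - h * series (pterm (fps_deriv c) x) n.+1) @ \oo -->
    psum c (x + h) - psum c x - h * psum (fps_deriv c) x.
  apply: cvgB; first apply: cvgB.
  - by rewrite (cvg_shiftS (fun n => series (pterm c (x + h)) n.+1)) cvg_shiftS.
  - by rewrite (cvg_shiftS (fun n => series (pterm c x) n.+1)) cvg_shiftS.
  - by apply: cvgMr; rewrite cvg_shiftS.
apply: (lim_norm_le lim_taylor) => n; rewrite partial_sum_taylor.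
apply: le_trans (ler_norm_sum _ _ _) _.
pose u k := `|c k.+2| * ('C(k + 2, 2)%:R * s ^+ k).
apply: (@le_trans _ _ (`|h| ^+ 2 * \sum_(k < n) `|u k|)).
  rewrite mulr_sumr; apply: ler_sum => k _; rewrite normrM /u normrM normr_id.
  rewrite [leRHS]mulrCA ler_wpM2l //.
  have w0 : 0 <= 'C(k + 2, 2)%:R * s ^+ k by rewrite mulr_ge0 // exprn_ge0 // ltW.
  rewrite (ger0_norm w0).
  by apply: taylor2_le; exact: ltW.
rewrite ler_wpM2l ?exprn_ge0 //; apply: binom_sum_le_bound => // k.
rewrite ger0_norm /u; last by rewrite !mulr_ge0 // exprn_ge0 // ltW.
have -> : M / rho ^+ 2 * ('C(k + 2, 2)%:R * t ^+ k) =
  M * ('C(k + 2, 2)%:R * t ^+ k) / rho ^+ 2 by ring.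
rewrite ler_pdivlMr ?exprn_gt0 //.
have -> : `|c k.+2| * ('C(k + 2, 2)%:R * s ^+ k) * rho ^+ 2 =
  (`|c k.+2| * rho ^+ k.+2) * ('C(k + 2, 2)%:R * t ^+ k).
  by rewrite sE exprMn !exprS; ring.
by rewrite ler_wpM2r // mulr_ge0 // exprn_ge0.
Qed.

Lemma psum_derivative c r f x :
    disc_bounded c r -> (forall y, `|y| < r -> f y = psum c y) -> `|x| < r ->
  (fun h => h^-1 *: (f (h + x) - f x)) @ 0^' --> psum (fps_deriv c) x.
Proof.
move=> cr fE xr; have [B B0 [delta delta0 dP]] := psum_taylor_le cr xr.
apply/cvgrPdist_le => e e0.
(* B may be 0, hence the quotient by B + 1 below. *)
have B1 : 0 < B + 1 by rewrite ltr_wpDl.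
have rx0 : 0 < r - `|x| by rewrite subr_gt0.
near=> h.
have h0 : h != 0 by near: h; exact: nbhs_dnbhs_neq.
have hd : `|h| < delta by near: h; exact: dnbhs0_lt.
have hr : `|h| < r - `|x| by near: h; exact: dnbhs0_lt.
have he : `|h| <= e / (B + 1) by near: h; apply: dnbhs0_le; rewrite divr_gt0.
rewrite distrC [h + x]addrC !fE //; last first.
  by apply: le_lt_trans (ler_normD _ _) _; rewrite -ltrBrDl.
have -> : h^-1 *: (psum c (x + h) - psum c x) - psum (fps_deriv c) x =
    h^-1 * (psum c (x + h) - psum c x - h * psum (fps_deriv c) x).
  by rewrite mulrBr mulKf.
rewrite normrM normfV ler_pdivrMl ?normr_gt0 //.
apply: le_trans (dP h hd) _; rewrite expr2 -mulrA ler_wpM2l //.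
apply: (@le_trans _ _ (e / (B + 1) * (B + 1))).
  by rewrite ler_pM // lerDl.
by rewrite divfK // gt_eqF.
Unshelve. all: by end_near.
Qed.

Lemma psum_derivable c r f x :
    disc_bounded c r -> (forall y, `|y| < r -> f y = psum c y) -> `|x| < r ->
  derivable f x 1 /\ theta f x = psum (fps_theta c) x.
Proof.
move=> cr fE xr; have cv := psum_derivative cr fE xr; split.
  apply/cvg_ex; exists (psum (fps_deriv c) x).
  by under eq_fun do rewrite /= scaler1.
rewrite /theta /derive1 (cvg_lim _ cv) //.
have cvd : pcvg (fps_deriv c) x.
  by apply: disc_bounded_pcvg xr; exact: disc_bounded_deriv.
by have [_ ->] := psumX cvd.
Qed.

(** Differentiation is local, so it is enough that f agrees with the sum on an
    open disc, and this property is inherited by theta f; hence the induction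
    over the operators. *)
Lemma op_prod_psum (cs : seq C) c r f :
    disc_bounded c r -> (forall y, `|y| < r -> f y = psum c y) ->
  disc_bounded (op_prod (@fps_theta C) cs c) r /\
  forall y, `|y| < r ->
    op_prod (@theta C) cs f y = psum (op_prod (@fps_theta C) cs c) y.
Proof.
move=> cr fE; elim: cs => [|a cs [IH1 IH2]] //=.
have tr := disc_bounded_theta IH1.
split; first by apply: disc_boundedD => //; exact: disc_boundedZ.
move=> y yr; have cy := disc_bounded_pcvg IH1 yr.
rewrite psumD; [|exact: disc_bounded_pcvg tr yr|exact: pcvgZ].
have [_ <-] := psum_derivable IH1 IH2 yr.
by rewrite psumZ // -IH2.
Qed.

End DiscOfConvergence.

(** * The symbolic substitution and its extreme coefficients *)

Section Substitution.
Variable K : comNzRingType.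
Implicit Types (lam : nat -> {poly {poly K}}) (e : {poly {poly {poly K}}}).

Lemma subst_thetaE lam e : subst_theta lam e =
  \poly_(j < size e) ('X * (e`_j)^`() - e`_j * lam j)
  + (\poly_(j < size e) (e`_j * lam j)) * 'X.
Proof.
rewrite !poly_def mulr_suml -big_split /subst_theta /=; apply: eq_bigr => j _.
by rewrite scalerBr scalerBl exprSr -scalerAl; ring.
Qed.

Lemma coef_subst_theta lam e i : (subst_theta lam e)`_i =
  'X * (e`_i)^`() - e`_i * lam i + (if i is i'.+1 then e`_i' * lam i' else 0).
Proof.
rewrite subst_thetaE coefD coefMX !coef_poly.
have -> : (if (i < size e)%N then 'X * (e`_i)^`() - e`_i * lam i else 0) =
    'X * (e`_i)^`() - e`_i * lam i.
  by case: ltnP => // ei; rewrite nth_default // deriv0 mulr0 mul0r subr0.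
by case: i => //= i; case: ltnP => // ei; rewrite (nth_default _ ei) mul0r.
Qed.

Lemma size_subst_theta lam e : (size (subst_theta lam e) <= (size e).+1)%N.
Proof.
apply/leq_sizeP => -[|i] // ei; rewrite coef_subst_theta.
have {}ei : (size e <= i)%N by [].
rewrite (nth_default _ ei) (nth_default _ (leqW ei)).
by rewrite deriv0 mulr0 !mul0r subr0 addr0.
Qed.

Lemma size_op_prod_subst lam (cs : seq {poly {poly K}}) :
  (size (op_prod (subst_theta lam) cs 1) <= (size cs).+1)%N.
Proof.
elim: cs => [|c cs IH] /=; first by rewrite size_poly1.
apply: leq_trans (size_polyD _ _) _; rewrite geq_max.
rewrite (leq_trans (size_subst_theta _ _)) //=.
by rewrite (leq_trans (size_scale_leq _ _)) // leqW.
Qed.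

(** Each operator contributes one factor lambda_j to the top coefficient; the
    Leibniz terms and the constants c only reach lower ones. *)
Lemma op_prod_subst_lead lam (cs : seq {poly {poly K}}) m : (size cs <= m)%N ->
  (op_prod (subst_theta lam) cs 1)`_m =
  if size cs == m then \prod_(j < m) lam j else 0.
Proof.
move=> csm; case: eqP => [<-{m csm}|/eqP neq]; last first.
  rewrite nth_default //; apply: leq_trans (size_op_prod_subst _ _) _.
  by rewrite ltn_neqAle neq.
elim: cs => [|c cs IH] /=; first by rewrite big_ord0 coef1.
rewrite coefD coefZ coef_subst_theta IH big_ord_recr /=.
rewrite nth_default ?size_op_prod_subst //.
by rewrite deriv0 !mulr0 mul0r subr0 add0r addr0.
Qed.

(** On the lowest coefficient theta acts as - lambda_0, since nothing is shifted
    into it and no x has appeared yet to be differentiated. *)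
Lemma op_prod_subst_coef0 lam (l : {poly K}) (ds : seq {poly K}) : lam 0%N = l%:P ->
  (op_prod (subst_theta lam) (map polyC ds) 1)`_0 = (\prod_(d <- ds) (d - l))%:P.
Proof.
move=> lam0; elim: ds => [|d ds IH] /=; first by rewrite big_nil coef1.
rewrite coefD coefZ coef_subst_theta IH derivC mulr0 add0r addr0 lam0 big_cons.
by rewrite -!polyCM -polyCN -polyCD; congr polyC; ring.
Qed.

(** The factor theta in front is theta + 0, which makes the left-hand side a
    product of q + 1 operators. *)
Lemma hyp_lhsE (A : pzRingType) (V : lmodType A) (th : V -> V) q (b : 'I_q -> A) (f : V) :
  hyp_lhs th b f = op_prod th (0 :: [seq b j - 1 | j : 'I_q]) f.
Proof. by rewrite /= scale0r addr0. Qed.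

(** Numerator and denominator parameters are treated at once by letting all
    parameters and shift factors be arbitrary polynomials in n. *)
Definition hyp_subst p q (e : 'I_p -> {poly K}) (d : 'I_q -> {poly K})
    (l : nat -> {poly K}) : {poly {poly {poly K}}} :=
  hyp_lhs (subst_theta (fun j => (l j)%:P)) (fun j => (d j)%:P) 1
  - 'X *: hyp_rhs (subst_theta (fun j => (l j)%:P)) (fun i => (e i)%:P) 1.

Variables (p q : nat) (e : 'I_p -> {poly K}) (d : 'I_q -> {poly K}).
Variable l : nat -> {poly K}.

Lemma hyp_lhs_polyC lam :
  hyp_lhs (subst_theta lam) (fun j => (d j)%:P) 1 =
  op_prod (subst_theta lam) (map polyC (0 :: [seq d j - 1 | j : 'I_q])) 1.
Proof.
rewrite hyp_lhsE /=; congr (op_prod _ (_ :: _) _).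
by rewrite -map_comp; apply: eq_map => j; rewrite /= polyCB.
Qed.

Lemma hyp_rhs_polyC lam :
  hyp_rhs (subst_theta lam) (fun i => (e i)%:P) 1 =
  op_prod (subst_theta lam) (map polyC [seq e i | i : 'I_p]) 1.
Proof. by rewrite /hyp_rhs -map_comp. Qed.

Let m := maxn p q.+1.

Lemma size_hyp_subst_le : (size (hyp_subst e d l) <= m.+1)%N.
Proof.
rewrite /hyp_subst hyp_lhs_polyC hyp_rhs_polyC.
apply: leq_trans (size_polyD _ _) _; rewrite size_polyN geq_max.
have sizeT lam cs : (size cs <= m)%N ->
    (size (op_prod (subst_theta lam) cs 1) <= m.+1)%N.
  by move=> csm; apply: leq_trans (size_op_prod_subst _ _) _.
rewrite sizeT ?(leq_trans (size_scale_leq _ _)) ?sizeT //=.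
  by rewrite size_map size_image card_ord leq_maxl.
by rewrite size_map size_image card_ord leq_maxr.
Qed.

Lemma hyp_subst_lead : (hyp_subst e d l)`_m =
  ((q.+1 == m)%:R - (p == m)%:R * 'X) * (\prod_(j < m) l j)%:P.
Proof.
rewrite /hyp_subst hyp_lhs_polyC hyp_rhs_polyC coefB coefZ.
have szL : size (map polyC (0 :: [seq d j - 1 | j : 'I_q])) = q.+1.
  by rewrite /= size_map size_image card_ord.
have szR : size (map polyC [seq e i | i : 'I_p]) = p.
  by rewrite /= size_map size_image card_ord.
rewrite !op_prod_subst_lead ?szL ?szR ?leq_maxl ?leq_maxr //.
rewrite rmorph_prod; set P := \prod_(j < m) _.
by case: (_ == m); case: (_ == m); rewrite /=; ring.
Qed.

Lemma hyp_subst_coef0 : (hyp_subst e d l)`_0 =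
  - (l 0%N * \prod_j (d j - 1 - l 0%N))%:P - (\prod_i (e i - l 0%N))%:P * 'X.
Proof.
rewrite /hyp_subst hyp_lhs_polyC hyp_rhs_polyC coefB coefZ.
rewrite !(op_prod_subst_coef0 (l := l 0%N)) // big_cons !big_image /=.
by rewrite sub0r mulNr polyCN [X in _ - X]mulrC.
Qed.

End Substitution.

Section SubstitutionDomain.
Variable K : idomainType.
Variables (p q : nat) (e : 'I_p -> {poly K}) (d : 'I_q -> {poly K}).
Variable l : nat -> {poly K}.
Hypothesis l_neq0 : forall j, l j != 0.

(** If p = q + 1 the top coefficients of the two sides combine to a multiple of
    1 - x, so they do not cancel. *)
Lemma hyp_subst_lead_neq0 : (hyp_subst e d l)`_(maxn p q.+1) != 0.
Proof.
rewrite hyp_subst_lead mulf_neq0 ?polyC_eq0 //; last by apply/prodf_neq0 => j _.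
have [pm|pm] := eqVneq p (maxn p q.+1).
  case: (q.+1 == _); rewrite ?mulr1n ?mulr0n mul1r; last by rewrite sub0r oppr_eq0 polyX_eq0.
  by rewrite -opprB oppr_eq0 -polyC1 polyXsubC_eq0.
have -> : q.+1 == maxn p q.+1 by case: leqP pm => //; rewrite ?eqxx.
by rewrite mulr1n mulr0n mul0r subr0 oner_eq0.
Qed.

Lemma size_hyp_subst : size (hyp_subst e d l) = (maxn p q.+1).+1.
Proof.
apply/eqP; rewrite eqn_leq size_hyp_subst_le /= ltnNge.
by apply: contra_neqN hyp_subst_lead_neq0 => /leq_sizeP ->.
Qed.

End SubstitutionDomain.

(** * Evaluation of shift expressions *)

Section Evaluation.
Variable C : numFieldType.
Implicit Types (g : nat -> nat -> C) (c : {poly {poly C}}) (e : {poly {poly {poly C}}}).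

Lemma at_nD c c' n : at_n (c + c') n = at_n c n + at_n c' n.
Proof. exact: rmorphD. Qed.

Lemma at_nM c c' n : at_n (c * c') n = at_n c n * at_n c' n.
Proof. exact: rmorphM. Qed.

Lemma at_nC (r : {poly C}) n : at_n r%:P n = r.[n]%:P.
Proof. exact: map_polyC. Qed.

Lemma at_nX (n : C) : at_n 'X n = 'X.
Proof. exact: map_polyX. Qed.

Lemma at_n0 (n : C) : at_n 0 n = 0.
Proof. exact: rmorph0. Qed.

Lemma at_n1 (n : C) : at_n 1 n = 1.
Proof. exact: rmorph1. Qed.

Lemma at_n_neq0 c n : (lead_coef c).[n] != 0 -> at_n c n != 0.
Proof.
apply: contra_neq => c0; have := congr1 (fun r : {poly C} => r`_(size c).-1) c0.
by rewrite coef0 /at_n coef_map.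
Qed.

(** The formal series denoted by a shift expression: 'X^j is read as g j, which
    will be the series with parameter n + j or n - j. *)
Definition seval n g e : nat -> C :=
  \sum_(j < size e) fps_mulp (at_n e`_j n) (g j).

Variables (n : C) (g : nat -> nat -> C).

Lemma seval_widen e N : (size e <= N)%N ->
  seval n g e = \sum_(j < N) fps_mulp (at_n e`_j n) (g j).
Proof.
move=> eN; rewrite /seval (big_ord_widen N (fun j => fps_mulp (at_n e`_j n) (g j)) eN).
rewrite big_mkcond; apply: eq_bigr => j _; case: ltnP => // ej.
by rewrite (nth_default _ ej) at_n0 fps_mulp0l.
Qed.

Lemma sevalD e e' : seval n g (e + e') = seval n g e + seval n g e'.
Proof.
pose N := maxn (size e) (size e').
rewrite !(@seval_widen _ N) ?leq_maxl ?leq_maxr ?size_polyD // -big_split.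
by apply: eq_bigr => j _; rewrite coefD at_nD fps_mulpDl.
Qed.

Lemma seval0 : seval n g 0 = 0.
Proof. by rewrite /seval size_poly0 big_ord0. Qed.

Lemma sevalC (r : {poly C}) e : seval n g (r%:P *: e) = r.[n] *: seval n g e.
Proof.
rewrite (@seval_widen _ (size e)) ?size_scale_leq // scaler_sumr.
by apply: eq_bigr => j _; rewrite coefZ at_nM at_nC mul_polyC fps_mulpZl.
Qed.

Lemma sevalB e e' : seval n g (e - e') = seval n g e - seval n g e'.
Proof.
have -> : - e' = (-1)%:P *: e' by rewrite polyCN polyC1 scaleN1r.
by rewrite sevalD sevalC hornerN hornerC scaleN1r.
Qed.

Lemma sevalX e : seval n g ('X *: e) = fps_mulp 'X (seval n g e).
Proof.
rewrite (@seval_widen _ (size e)) ?size_scale_leq //.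
have -> : fps_mulp 'X (seval n g e) =
    \sum_(j < size e) fps_mulp 'X (fps_mulp (at_n e`_j n) (g j)).
  rewrite /seval; elim/big_rec2: _ => [|j u v _ <-]; first exact: fps_mulp0r.
  exact: fps_mulpDr.
by apply: eq_bigr => j _; rewrite coefZ at_nM at_nX fps_mulpXM.
Qed.

Lemma sevalXn c j : seval n g (c *: 'X^j) = fps_mulp (at_n c n) (g j).
Proof.
rewrite (@seval_widen _ j.+1); last first.
  by rewrite (leq_trans (size_scale_leq _ _)) ?size_polyXn.
rewrite big_ord_recr /= coefZ coefXn eqxx mulr1 big1 ?add0r // => i _.
by rewrite coefZ coefXn ltn_eqF // mulr0 at_n0 fps_mulp0l.
Qed.

Lemma seval_sum N (e : nat -> {poly {poly {poly C}}}) :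
  seval n g (\sum_(j < N) e j) = \sum_(j < N) seval n g (e j).
Proof. by elim/big_rec2: _ => [|j u v _ <-]; [exact: seval0 | exact: sevalD]. Qed.

Variable l : nat -> {poly C}.

(** By the Leibniz rule it is enough to treat theta (g j), where the derivative
    rule applies.  It is required only for the terms that occur in e, because
    for denominator parameters it fails near the forbidden values. *)
Lemma seval_subst_theta e :
    (forall j, (j < size e)%N -> fps_theta (g j) = (l j).[n] *: (g j.+1 - g j)) ->
  seval n g (subst_theta (fun j => (l j)%:P) e) = fps_theta (seval n g e).
Proof.
move=> rule; rewrite /subst_theta (seval_sum _ (fun j => ('X * (e`_j)^`()) *: 'X^j
  + (e`_j * (l j)%:P) *: ('X^(j.+1) - 'X^j))).
have -> : fps_theta (seval n g e) =
    \sum_(j < size e) fps_theta (fps_mulp (at_n e`_j n) (g j)).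
  rewrite /seval; elim/big_rec2: _ => [|j u v _ <-]; first exact: fps_theta0.
  exact: fps_thetaD.
apply: eq_bigr => j _; rewrite fps_theta_mulp rule // scalerBr sevalD sevalB !sevalXn.
rewrite !at_nM at_nX at_nC /at_n -deriv_map; congr (_ + _).
by rewrite -fps_mulpBr [_ * _%:P]mulrC mul_polyC fps_mulpZl fps_mulpZr.
Qed.

(** After i operators the expression has degree at most i, so the rule is used
    only for j < size ds. *)
Lemma seval_op_prod (ds : seq {poly C}) :
    (forall j, (j < size ds)%N -> fps_theta (g j) = (l j).[n] *: (g j.+1 - g j)) ->
  seval n g (op_prod (subst_theta (fun j => (l j)%:P)) (map polyC ds) 1) =
  op_prod (@fps_theta C) [seq d.[n] | d <- ds] (g 0%N).
Proof.
elim: ds => [|d ds IH] rule /=.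
  have -> : (1 : {poly {poly {poly C}}}) = 1 *: 'X^0 by rewrite scale1r expr0.
  by rewrite sevalXn at_n1 -polyC1 fps_mulpC scale1r.
rewrite sevalD sevalC IH => [|j jd]; last by apply: rule; exact: leqW.
have rule' j : (j < size ds)%N -> fps_theta (g j) = (l j).[n] *: (g j.+1 - g j).
  by move=> jd; apply: rule; exact: leqW.
rewrite seval_subst_theta ?IH // => j jd; apply: rule.
by apply: leq_trans jd _; rewrite (leq_trans (size_op_prod_subst _ _)) ?size_map //.
Qed.

End Evaluation.

(** * The recurrence equation *)

Section Recurrence.
Variable C : numFieldType.
Implicit Types (n x : C) (D : set C).

(** The symbolic equation evaluates to the difference of the two sides of the
    differential equation of g 0. *)
Lemma hyp_subst_recurrence p q (e : 'I_p -> {poly C}) (d : 'I_q -> {poly C})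
    (l : nat -> {poly C}) n (g : nat -> nat -> C) :
  let m := maxn p q.+1 in
    (forall j, (j < m)%N -> fps_theta (g j) = (l j).[n] *: (g j.+1 - g j)) ->
    hyp_lhs (@fps_theta C) (fun j => (d j).[n]) (g 0%N) =
      fps_mulp 'X (hyp_rhs (@fps_theta C) (fun i => (e i).[n]) (g 0%N)) ->
  \sum_(j < m.+1) fps_mulp (at_n (hyp_subst e d l)`_j n) (g j) = 0.
Proof.
move=> m rule ode; rewrite -(seval_widen _ _ (size_hyp_subst_le e d l)).
rewrite /hyp_subst sevalB sevalX hyp_lhs_polyC hyp_rhs_polyC.
rewrite !seval_op_prod; first last.
- move=> j; rewrite /= size_image card_ord => jq; apply: rule.
  by apply: leq_trans jq _; exact: leq_maxr.
- move=> j; rewrite size_image card_ord => jp; apply: rule.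
  by apply: leq_trans jp _; exact: leq_maxl.
have mapL : [seq r.[n] | r <- [seq d j - 1 | j : 'I_q]] =
    [seq (d j).[n] - 1 | j : 'I_q].
  by rewrite -map_comp; apply: eq_map => j; rewrite /= !hornerE.
have mapR : [seq r.[n] | r <- [seq e i | i : 'I_p]] = [seq (e i).[n] | i : 'I_p].
  by rewrite -map_comp.
rewrite map_cons mapL mapR horner0 -hyp_lhsE ode.
exact: subrr.
Qed.

Lemma subst_numE p q (a : 'I_p -> C) (b : 'I_q -> C) (k : 'I_p) :
  subst_num a b k = hyp_subst [eta (fun i => (a i)%:P) with k |-> 'X]
    (fun j => (b j)%:P) (fun j => 'X + j%:R).
Proof.
rewrite /subst_num /hyp_subst.
have -> : @lam_num C = (fun j => ('X + j%:R)%:P).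
  by apply/funext => j; rewrite /lam_num polyCD polyC_natr.
congr (_ - _ *: hyp_rhs _ _ _).
by apply/funext => i /=; case: ifP.
Qed.

Lemma subst_denE p q (a : 'I_p -> C) (b : 'I_q -> C) (k : 'I_q) :
  subst_den a b k = hyp_subst (fun i => (a i)%:P)
    [eta (fun j => (b j)%:P) with k |-> 'X] (fun j => 'X - j%:R - 1).
Proof.
rewrite /subst_den /hyp_subst.
have -> : @lam_den C = (fun j => ('X - j%:R - 1)%:P).
  by apply/funext => j; rewrite /lam_den !polyCB polyC_natr polyC1.
congr (hyp_lhs _ _ _ - _).
by apply/funext => i /=; case: ifP.
Qed.

Lemma lam_num_neq0 j : 'X + j%:R != 0 :> {poly C}.
Proof. by rewrite -[j%:R]opprK -polyC_natr -polyCN polyXsubC_eq0. Qed.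

Lemma lam_den_neq0 j : 'X - j%:R - 1 != 0 :> {poly C}.
Proof. by rewrite -addrA -opprD -polyC_natr -polyC1 -polyCD polyXsubC_eq0. Qed.

Lemma size_subst_num p q (a : 'I_p -> C) (b : 'I_q -> C) (k : 'I_p) :
  size (subst_num a b k) = (maxn p q.+1).+1.
Proof. by rewrite subst_numE size_hyp_subst //; exact: lam_num_neq0. Qed.

Lemma size_subst_den p q (a : 'I_p -> C) (b : 'I_q -> C) (k : 'I_q) :
  size (subst_den a b k) = (maxn p q.+1).+1.
Proof. by rewrite subst_denE size_hyp_subst //; exact: lam_den_neq0. Qed.

(** theta + n maps F_n to n F_(n+1), so the right-hand side, which contains this
    factor, has no term in F_n. *)
Lemma subst_num_coef0_neq0 p q (a : 'I_p -> C) (b : 'I_q -> C) (k : 'I_p) :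
  (subst_num a b k)`_0 != 0.
Proof.
rewrite subst_numE hyp_subst_coef0 [X in _ - X%:P * _](bigD1 k) //= eqxx.
rewrite addr0 subrr mul0r mul0r subr0 oppr_eq0 polyC_eq0 mulf_neq0 ?polyX_eq0 //.
apply/prodf_neq0 => j _; rewrite -oppr_eq0 opprB -polyC1 -polyCB.
by rewrite polyXsubC_eq0.
Qed.

(** theta + n - 1 maps F_n to (n - 1) F_(n-1), so the left-hand side, which
    contains this factor, has no term in F_n. *)
Lemma subst_den_coef0_neq0 p q (a : 'I_p -> C) (b : 'I_q -> C) (k : 'I_q) :
  (subst_den a b k)`_0 != 0.
Proof.
rewrite subst_denE hyp_subst_coef0 [X in (_ * X)%:P](bigD1 k) //= eqxx.
rewrite subr0 subrr mul0r mulr0 oppr0 add0r oppr_eq0 mulf_neq0 ?polyX_eq0 //.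
rewrite polyC_eq0; apply/prodf_neq0 => i _; rewrite opprB addrC -addrA -oppr_eq0.
have -> : - (1 + (- 'X + (a i)%:P)) = 'X - (a i + 1)%:P :> {poly C}.
  by rewrite polyCD polyC1; ring.
by rewrite polyXsubC_eq0.
Qed.

Lemma shift_param_neq0 (r : {poly {poly C}}) (c : C) : r != 0 ->
  map_poly (fun s : {poly C} => s \Po ('X - c%:P)) r != 0.
Proof.
apply: contra_neq => E; apply/polyP => i; rewrite coef0.
have := congr1 (fun s : {poly {poly C}} => s`_i) E.
rewrite /= coef_map_id0 ?comp_poly0 // coef0 => /eqP.
by rewrite comp_poly2_eq0 ?size_XsubC // => /eqP.
Qed.

Lemma at_n_shift (r : {poly {poly C}}) (c n : C) :
  at_n (map_poly (fun s : {poly C} => s \Po ('X - c%:P)) r) n = at_n r (n - c).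
Proof.
apply/polyP => i; rewrite /at_n !coef_map /=.
by rewrite /horner_eval horner_comp !hornerE.
Qed.

Lemma rec_num_neq0 p q (a : 'I_p -> C) (b : 'I_q -> C) (k : 'I_p) :
  rec_num a b k 0 != 0 /\ rec_num a b k (maxn p q.+1) != 0.
Proof.
rewrite /rec_num -polyC_natr subn0 subnn; split; apply: shift_param_neq0.
  by rewrite subst_numE hyp_subst_lead_neq0 //; exact: lam_num_neq0.
exact: subst_num_coef0_neq0.
Qed.

Lemma rec_den_neq0 p q (a : 'I_p -> C) (b : 'I_q -> C) (k : 'I_q) :
  rec_den a b k 0 != 0 /\ rec_den a b k (maxn p q.+1) != 0.
Proof.
split; first exact: subst_den_coef0_neq0.
by rewrite /rec_den subst_denE hyp_subst_lead_neq0 //; exact: lam_den_neq0.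
Qed.

(** The substitution produces F_n, ..., F_(n+m); started at n - m and read
    backwards, it is the required recurrence. *)
Lemma fps_recurrence_num p q (a : 'I_p -> C) (b : 'I_q -> C) (k : 'I_p) n :
    (forall j, ~ nonpos_int (b j)) ->
  \sum_(j < (maxn p q.+1).+1) fps_mulp (at_n (rec_num a b k j) n)
    (hyp_coef [eta a with k |-> n - j%:R] b) = 0.
Proof.
move=> hb; set m := maxn p q.+1.
pose g j := hyp_coef [eta a with k |-> n - m%:R + j%:R] b.
have := @hyp_subst_recurrence p q [eta (fun i => (a i)%:P) with k |-> 'X]
  (fun j => (b j)%:P) (fun j => 'X + j%:R) (n - m%:R) g.
rewrite -/m /= -subst_numE => rec.
rewrite (reindex_inj rev_ord_inj) /= -[RHS]rec.
- apply: eq_bigr => j _; rewrite subSS /rec_num -/m subKn ?leq_ord //.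
  rewrite -polyC_natr at_n_shift; congr (fps_mulp _ _).
  rewrite /g natrB ?leq_ord // opprB; congr (hyp_coef _ _).
  by apply/funext => i /=; case: ifP => // _; ring.
- move=> j _; rewrite /g fps_theta_num -natr1 addrA !hornerE.
  by rewrite -polyC_natr hornerC.
- have odeP := fps_hyp_ode [eta a with k |-> n - m%:R] hb.
  have -> : g 0%N = hyp_coef [eta a with k |-> n - m%:R] b by rewrite /g addr0.
  have -> : (fun j => (b j)%:P.[n - m%:R]) = b by apply/funext => j; rewrite hornerC.
  rewrite odeP; congr (fps_mulp _ (hyp_rhs _ _ _)); apply/funext => i /=.
  by case: ifP; rewrite !hornerE.
Qed.

Lemma fps_recurrence_den p q (a : 'I_p -> C) (b : 'I_q -> C) (k : 'I_q) n :
    (forall j, ~ nonpos_int (b j)) ->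
    (forall j, (j <= maxn p q.+1)%N -> ~ nonpos_int (n - j%:R)) ->
  \sum_(j < (maxn p q.+1).+1) fps_mulp (at_n (rec_den a b k j) n)
    (hyp_coef a [eta b with k |-> n - j%:R]) = 0.
Proof.
move=> hb; set m := maxn p q.+1 => hn.
pose g j := hyp_coef a [eta b with k |-> n - j%:R].
have := @hyp_subst_recurrence p q (fun i => (a i)%:P)
  [eta (fun j => (b j)%:P) with k |-> 'X] (fun j => 'X - j%:R - 1) n g.
rewrite -/m /= -subst_denE; apply.
- move=> j jm; rewrite /g.
  have nj1 : n - j.+1%:R = n - j%:R - 1 by rewrite -natr1; ring.
  rewrite nj1 fps_theta_den -?nj1; [|exact: hn (ltnW jm)|exact: hn].
  by rewrite nj1 -polyC_natr !hornerE.
- have hb' j : ~ nonpos_int ([eta b with k |-> n] j).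
    move=> /=; case: ifP => _; last exact: hb.
    by have := hn 0%N isT; rewrite subr0.
  have odeP := fps_hyp_ode a hb'.
  have -> : g 0%N = hyp_coef a [eta b with k |-> n] by rewrite /g subr0.
  have -> : (fun i => (a i)%:P.[n]) = a by apply/funext => j; rewrite hornerC.
  rewrite -odeP; congr (hyp_lhs _ _ _); apply/funext => i /=.
  by case: ifP; rewrite !hornerE.
Qed.

Lemma psum_recurrence m (r : 'I_m -> {poly C}) (g : 'I_m -> nat -> C) x :
    (forall j, pcvg (g j) x) -> \sum_j fps_mulp (r j) (g j) = 0 ->
  \sum_j (r j).[x] * psum (g j) x = 0.
Proof.
move=> gx E; have [_ z] := psum0 x; rewrite -[RHS]z -E psum_sum; last first.
  by move=> j; have [] := psum_mulp (r j) (gx j).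
by apply: eq_bigr => j _; have [_ ->] := psum_mulp (r j) (gx j).
Qed.

(** * Admissibility *)

(** A shift-closed set contains an infinite ray, and a nonzero polynomial has
    finitely many roots. *)
Lemma shift_closed_nonroot D (P : {poly C}) m :
    D !=set0 -> shift_closed D -> P != 0 ->
  exists2 n, (forall k, (k <= m)%N -> D (n - k%:R)) & P.[n] != 0.
Proof.
move=> [n0 Dn0] Dshift P0.
have [u [u_inj uD]] : exists u : nat -> C, injective u /\
    forall i k, (k <= m)%N -> D (u i - k%:R).
  case: Dshift => Dshift.
    (* Starting m steps up the ray keeps all n - k with k <= m in D. *)
    exists (fun i => n0 + (m + i)%:R); split=> [i j /addrI/eqP|i k km].
      by rewrite eqr_nat eqn_add2l => /eqP.
    rewrite -addrA -natrB; last by rewrite (leq_trans km) ?leq_addr.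
    elim: (_ - _)%N => [|j IH]; first by rewrite addr0.
    by rewrite -natr1 addrA; exact: Dshift.
  exists (fun i => n0 - i%:R); split=> [i j /addrI/oppr_inj/eqP|i k _].
    by rewrite eqr_nat => /eqP.
  rewrite -addrA -opprD -natrD.
  elim: (_ + _)%N => [|j IH]; first by rewrite subr0.
  by rewrite -natr1 opprD addrA; exact: Dshift.
pose s := [seq u i | i <- iota 0 (size P)].
have [/allP Proots|] := boolP (all (root P) s).
  have : (size s < size P)%N.
    apply: max_poly_roots => //; first exact/allP.
    by rewrite map_inj_uniq ?iota_uniq.
  by rewrite size_map size_iota ltnn.
move=> /allPn[_ /mapP[i _ ->] ni].
by exists (u i) => // k; exact: uD.
Qed.

Section Admissibility.
Variables (D : set C) (m : nat) (s : C) (lam : C -> C) (q : nat -> {poly {poly C}}).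
Hypotheses (D0 : D !=set0) (Dshift : shift_closed D) (s1 : s = 1 \/ s = - 1).
Hypotheses (q0 : q 0%N != 0) (qm : q m != 0).

Lemma nonvanishing_coef (r : {poly {poly C}}) : r != 0 ->
  exists2 n, (forall k, (k <= m)%N -> D (n - k%:R)) & at_n r n != 0.
Proof.
rewrite -lead_coef_eq0 => r0.
have [n nD rn] := shift_closed_nonroot m D0 Dshift r0.
by exists n => //; exact: at_n_neq0.
Qed.

(** The rule theta F_n = lam n (F_(n+s) - F_n) is divided by x to give the
    derivative rule, with common denominator 'X and two terms. *)
Lemma fps_admissible_intro (G : C -> nat -> C) :
    (forall n, D n -> D (n + s) -> fps_theta (G n) = lam n *: (G (n + s) - G n)) ->
    (forall n, (forall k, (k <= m)%N -> D (n - k%:R)) ->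
       \sum_(k < m.+1) fps_mulp (at_n (q k) n) (G (n - k%:R)) = 0) ->
  fps_admissible D G m.
Proof.
move=> rule rec; split=> //.
  suff H : fps_derivative_rule D G s by case: s1 H => ->; [right | left].
  exists 2%N, (fun k n => (if k is 0%N then - lam n else lam n)%:P), (fun=> 'X).
  split=> [n|n Dn Dk]; first by rewrite polyX_eq0.
  have Dn1 : D (n + s) by have := Dk 1%N isT; rewrite mulr1.
  rewrite [LHS]rule // !big_ord_recr big_ord0 /= add0r mulr0 addr0 mulr1.
  by rewrite !fps_mulpC scaleNr addrC scalerBr.
by exists (fun k n => at_n (q k) n); split=> //; exact: nonvanishing_coef.
Qed.

Lemma admissible_intro (U : set C) (F : C -> C -> C) :
    (forall n x, D n -> D (n + s) -> U x -> derivable (F n) x 1 /\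
       theta (F n) x = lam n * (F (n + s) x - F n x)) ->
    (forall n x, (forall k, (k <= m)%N -> D (n - k%:R)) -> U x ->
       \sum_(k < m.+1) (at_n (q k) n).[x] * F (n - k%:R) x = 0) ->
  admissible D U F m.
Proof.
move=> rule rec; split=> //.
  suff H : derivative_rule D U F s by case: s1 H => ->; [right | left].
  exists 2%N, (fun k n => (if k is 0%N then - lam n else lam n)%:P), (fun _ _ => 'X).
  split=> [_ _|n x Dn Dk Ux den0]; first by rewrite polyX_eq0.
  have Dn1 : D (n + s) by have := Dk 1%N isT; rewrite mulr1.
  (* The rule is only claimed where the denominator x does not vanish. *)
  have x0 : x != 0 by have := den0 0%N isT; rewrite hornerX.
  have [dF thetaF] := rule n x Dn Dn1 Ux; split=> //.
  rewrite !big_ord_recr big_ord0 /= add0r mulr0 addr0 mulr1 !hornerE.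
  by apply: (mulfI x0); rewrite [LHS]thetaF; field.
by exists (fun k n => at_n (q k) n); split=> //; exact: nonvanishing_coef.
Qed.

End Admissibility.

End Recurrence.

(** * The hypergeometric function *)

Section HypergeometricFunction.
Variable C : numFieldType.
Hypothesis Ccomplete : abs_complete C.
Variables (p q : nat).
Implicit Types (a : 'I_p -> C) (b : 'I_q -> C) (x : C).

Lemma hyp_disc_bounded a b x : hyp_disc a b x ->
  exists2 r, `|x| < r & disc_bounded (hyp_coef a b) r.
Proof. by move=> [z xz cz]; exists `|z| => //; exact: pcvg_disc_bounded. Qed.

Lemma hyp_disc_pcvg a b x : hyp_disc a b x -> pcvg (hyp_coef a b) x.
Proof.
by move=> /hyp_disc_bounded[r xr br]; exact: (disc_bounded_pcvg Ccomplete br xr).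
Qed.

Lemma hyp_ode a b x : (forall j, ~ nonpos_int (b j)) -> hyp_disc a b x ->
  hyp_lhs (@theta C) b (hyp_fun a b) x = x * hyp_rhs (@theta C) a (hyp_fun a b) x.
Proof.
move=> hb /hyp_disc_bounded[r xr br].
have E cs := op_prod_psum Ccomplete cs br (fun y _ => erefl (hyp_fun a b y)).
have [bR ER] := E [seq a i | i : 'I_p].
have [_ EL] := E (0 :: [seq b j - 1 | j : 'I_q]).
rewrite hyp_lhsE EL // -hyp_lhsE fps_hyp_ode // /hyp_rhs ER //.
by have [_ ->] := psumX (disc_bounded_pcvg Ccomplete bR xr).
Qed.

Lemma hyp_derivative_rule a b a' b' x (c : C) :
    hyp_disc a b x -> hyp_disc a' b' x ->
    fps_theta (hyp_coef a b) = c *: (hyp_coef a' b' - hyp_coef a b) ->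
  derivable (hyp_fun a b) x 1 /\
  theta (hyp_fun a b) x = c * (hyp_fun a' b' x - hyp_fun a b x).
Proof.
move=> dx /hyp_disc_pcvg cx' E; have cx := hyp_disc_pcvg dx.
have [r xr br] := hyp_disc_bounded dx.
have [dF ->] := psum_derivable Ccomplete br (fun y _ => erefl (hyp_fun a b y)) xr.
split=> //; rewrite E psumZ; last first.
  by apply: pcvgD => //; rewrite -scaleN1r; exact: pcvgZ.
by rewrite psumB.
Qed.

End HypergeometricFunction.

(** * The theorem *)

Theorem theorem3 (R : realType) (p q : nat)
    (a : 'I_p -> complexField R) (b : 'I_q -> complexField R)
    (hb : forall j, ~ nonpos_int (b j)) :
  (* the hypergeometric differential equation *)
  (hyp_lhs (@fps_theta (complexField R)) b (hyp_coef a b) =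
     fps_mulp (K := complexField R) 'X (hyp_rhs (@fps_theta (complexField R)) a (hyp_coef a b))
   /\
   forall x : complexField R, hyp_disc a b x ->
     hyp_lhs (@theta (complexField R)) b (hyp_fun a b) x =
       x * hyp_rhs (@theta (complexField R)) a (hyp_fun a b) x)
  /\
  (* numerator parameters *)
  (forall k : 'I_p,
    let m := maxn p q.+1 in
    let G := fun n : complexField R => hyp_coef [eta a with k |-> n] b in
    let F := fun n : complexField R => hyp_fun [eta a with k |-> n] b in
    let Om := fun n : complexField R => hyp_disc [eta a with k |-> n] b in
    [/\ (* derivative rule *)
        (forall n : complexField R, fps_theta (G n) = n *: (G (n + 1) - G n))
        /\ (forall n x : complexField R, Om n x -> Om (n + 1) x ->
              derivable (F n) x 1 /\
              theta (F n) x = n * (F (n + 1) x - F n x)),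
        (* the substitution yields an expression of order m *)
        size (subst_num a b k) = m.+1
        /\ rec_num a b k 0%N != 0 /\ rec_num a b k m != 0,
        (* the resulting recurrence equation *)
        (forall n : complexField R, \sum_(j < m.+1)
            fps_mulp (K := complexField R) (at_n (rec_num a b k j) n) (G (n - j%:R)) = 0)
        /\ (forall n x : complexField R, (forall j, (j <= m)%N -> Om (n - j%:R) x) ->
              \sum_(j < m.+1)
                (at_n (rec_num a b k j) n).[x] * F (n - j%:R) x = 0)
      & (* admissibility *)
        forall D : set (complexField R), D !=set0 -> shift_closed D ->
          fps_admissible D G m
          /\ admissible D [set x | forall n, D n -> Om n x] F m])
  /\
  (* denominator parameters *)
  (forall k : 'I_q,
    let m := maxn p q.+1 in
    let G := fun n : complexField R => hyp_coef a [eta b with k |-> n] in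
    let F := fun n : complexField R => hyp_fun a [eta b with k |-> n] in
    let Om := fun n : complexField R => hyp_disc a [eta b with k |-> n] in
    [/\ (forall n : complexField R, ~ nonpos_int n -> ~ nonpos_int (n - 1) ->
           fps_theta (G n) = (n - 1) *: (G (n - 1) - G n))
        /\ (forall n x : complexField R, ~ nonpos_int n -> ~ nonpos_int (n - 1) ->
              Om n x -> Om (n - 1) x ->
              derivable (F n) x 1 /\
              theta (F n) x = (n - 1) * (F (n - 1) x - F n x)),
        size (subst_den a b k) = m.+1
        /\ rec_den a b k 0%N != 0 /\ rec_den a b k m != 0,
        (forall n : complexField R, (forall j, (j <= m)%N -> ~ nonpos_int (n - j%:R)) ->
           \sum_(j < m.+1)
             fps_mulp (K := complexField R) (at_n (rec_den a b k j) n) (G (n - j%:R)) = 0)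
        /\ (forall n x : complexField R, (forall j, (j <= m)%N -> ~ nonpos_int (n - j%:R)) ->
              (forall j, (j <= m)%N -> Om (n - j%:R) x) ->
              \sum_(j < m.+1)
                (at_n (rec_den a b k j) n).[x] * F (n - j%:R) x = 0)
      & forall D : set (complexField R), D !=set0 -> shift_closed D ->
          (forall n, D n -> ~ nonpos_int n) ->
          fps_admissible D G m
          /\ admissible D [set x | forall n, D n -> Om n x] F m]).
Proof.
have Cc := @complex_abs_complete R; set C := complexField R in Cc *.
split; first split.
- exact: (fps_hyp_ode a hb).
- by move=> x dx; exact: (hyp_ode Cc hb dx).
split=> k m G F Om.
- have rule n : fps_theta (G n) = n *: (G (n + 1) - G n) by exact: fps_theta_num.
  have frule n x : Om n x -> Om (n + 1) x ->
      derivable (F n) x 1 /\ theta (F n) x = n * (F (n + 1) x - F n x).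
    by move=> d0 d1; exact: (hyp_derivative_rule Cc d0 d1 (rule n)).
  have rec n := fps_recurrence_num a k n hb.
  have frec n x : (forall j, (j <= m)%N -> Om (n - j%:R) x) ->
      \sum_(j < m.+1) (at_n (rec_num a b k j) n).[x] * F (n - j%:R) x = 0.
    move=> dn; apply: (psum_recurrence _ (rec n)) => j.
    by apply: (hyp_disc_pcvg Cc); apply: dn; exact: leq_ord.
  have [r0 rm] := rec_num_neq0 a b k.
  split=> //; first by split=> //; exact: size_subst_num.
  move=> D D0 Ds; split.
    apply: (fps_admissible_intro (s := 1) (lam := id) (q := rec_num a b k)) => //.
    by left.
  apply: (admissible_intro (s := 1) (lam := id) (q := rec_num a b k)) => //.
  + by left.
  + by move=> n x Dn Dn1 Ux; apply: frule; exact: Ux.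
  + by move=> n x Dn Ux; apply: frec => j jm; apply: Ux; exact: Dn.
- have rule n : ~ nonpos_int n -> ~ nonpos_int (n - 1) ->
      fps_theta (G n) = (n - 1) *: (G (n - 1) - G n).
    by move=> n0 n1; exact: fps_theta_den.
  have frule n x : ~ nonpos_int n -> ~ nonpos_int (n - 1) -> Om n x -> Om (n - 1) x ->
      derivable (F n) x 1 /\ theta (F n) x = (n - 1) * (F (n - 1) x - F n x).
    by move=> n0 n1 d0 d1; exact: (hyp_derivative_rule Cc d0 d1 (rule n n0 n1)).
  have rec n hn := @fps_recurrence_den _ p q a b k n hb hn.
  have frec n x : (forall j, (j <= m)%N -> ~ nonpos_int (n - j%:R)) ->
      (forall j, (j <= m)%N -> Om (n - j%:R) x) ->
      \sum_(j < m.+1) (at_n (rec_den a b k j) n).[x] * F (n - j%:R) x = 0.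
    move=> hn dn; apply: (psum_recurrence _ (rec n hn)) => j.
    by apply: (hyp_disc_pcvg Cc); apply: dn; exact: leq_ord.
  have [r0 rm] := rec_den_neq0 a b k.
  split=> //; first by split=> //; exact: size_subst_den.
  move=> D D0 Ds Dn0; split.
    apply: (fps_admissible_intro (s := - 1) (lam := fun n => n - 1)
      (q := rec_den a b k)) => //.
    + by right.
    + by move=> n Dn Dn1; apply: rule; exact: Dn0.
    + by move=> n Dn; apply: rec => j jm; apply: Dn0; exact: Dn.
  apply: (admissible_intro (s := - 1) (lam := fun n => n - 1)
    (q := rec_den a b k)) => //.
  + by right.
  + move=> n x Dn Dn1 Ux; apply: frule; [exact: Dn0|exact: Dn0|exact: Ux|exact: Ux].
  + move=> n x Dn Ux; apply: frec => j jm; first by apply: Dn0; exact: Dn.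
    by apply: Ux; exact: Dn.
Qed.
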